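(* Let $\chi_1,\chi_2$ be primitive Dirichlet characters with conductors $q_1,q_2>1$ respectively, such that $\chi_1\chi_2(-1)=1$, and let $N=q_1q_2$. There is an algorithm which, given $\gamma=\begin{pmatrix} a&b\\ c&d\end{pmatrix}\in\Gamma_0(N)$ with $c\geq 1$, computes $S_{\chi_1,\chi_2}(\gamma)$, and whose running time as a function of $\gamma$, for fixed $q_1,q_2$ (equivalently, fixed $\chi_1,\chi_2$), is $O(\log(c))$ in the model of computation described in the context.
   Context: $\Gamma_0(N)$ denotes the subgroup of $\mathrm{SL}_2(\mathbb{Z})$ of matrices $\begin{pmatrix} a&b\\ c&d\end{pmatrix}$ with $c\equiv 0 \pmod N$. Let $B_1(x)=0$ if $x\in\mathbb{Z}$ and $B_1(x)=x-\lfloor x\rfloor-\tfrac12$ otherwise. For $\gamma=\begin{pmatrix} a&b\\ c&d\end{pmatrix}\in\Gamma_0(q_1q_2)$ with $c\ge 1$, the generalized Dedekind sum is $$S_{\chi_1,\chi_2}(\gamma)=\sum_{j=1}^{c}\sum_{i=1}^{q_1}\overline{\chi_2(j)\chi_1(i)}\,B_1\!\left(\frac{j}{c}\right)B_1\!\left(\frac{i}{q_1}+\frac{aj}{c}\right).$$ Model of computation: a multiplication of two $2\times 2$ integer matrices counts as one operation; inverting a matrix in $\mathrm{SL}_2(\mathbb{Z})$ takes constant time; values of Dedekind sums lie in a cyclotomic field and are represented as linear combinations of powers of a fixed root of unity, and addition and multiplication of such values take constant time. Any precomputation that depends only on $\chi_1,\chi_2$ (and not on $\gamma$) is not counted as a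 function of $\gamma$. *)

(* Defs.v *)
From HB Require Import structures.
From mathcomp Require Import all_boot all_order all_algebra all_field.
Set Implicit Arguments. Unset Strict Implicit. Unset Printing Implicit Defensive.
Import Order.TTheory GRing.Theory Num.Theory.
Local Open Scope ring_scope.

Definition dirichlet_char (q : nat) (chi : int -> algC) : Prop :=
  [/\ forall m n : int, chi (m * n) = chi m * chi n,
      chi 1 = 1,
      forall n : int, chi (n + q%:Z) = chi n
    & forall n : int, (chi n != 0) = coprimez n q%:Z].

(* Primitive character of conductor q: a character mod q which is not induced
   from any proper divisor d of q, i.e. for every divisor d < q of q there is
   n = 1 (mod d), coprime to q, with chi n <> 1. *)
Definition primitive_char (q : nat) (chi : int -> algC) : Prop :=
  dirichlet_char q chi /\
  forall d : nat, (d %| q)%N -> (d < q)%N ->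
    exists n : int, [/\ (n == 1 %[mod d%:Z])%Z, coprimez n q%:Z & chi n != 1].

Definition i0 : 'I_2 := @Ordinal 2 0 isT.
Definition i1 : 'I_2 := @Ordinal 2 1 isT.
Definition mat_a (g : 'M[int]_2) := g i0 i0.
Definition mat_b (g : 'M[int]_2) := g i0 i1.
Definition mat_c (g : 'M[int]_2) := g i1 i0.
Definition mat_d (g : 'M[int]_2) := g i1 i1.

Definition Gamma0 (N : nat) (g : 'M[int]_2) : Prop :=
  \det g = 1 /\ (N%:Z %| mat_c g)%Z.

Definition B1 (x : rat) : rat :=
  if x \is a Num.int then 0 else x - (Num.floor x)%:~R - 2^-1.

Definition dedekindS (q1 : nat) (chi1 chi2 : int -> algC) (g : 'M[int]_2)
  : algC :=
  let a := mat_a g in let c := mat_c g in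
  \sum_(1 <= j < (absz c).+1) \sum_(1 <= i < q1.+1)
     (chi2 j%:Z * chi1 i%:Z)^* *
     ratr (B1 (j%:Q / c%:~R)) *
     ratr (B1 (i%:Q / q1%:Q + a%:~R * j%:Q / c%:~R)).

(* A register machine with three register files: integers, 2x2 integer
   matrices, and values in the (algebraic closure containing the) cyclotomic
   field.  Every instruction costs one step: integer arithmetic, building /
   reading a matrix, multiplying two matrices, inverting a matrix of SL_2(Z)
   (adjugate), arithmetic of values, comparisons/jumps.  Constants embedded
   in the program (integers and values) may depend on chi1, chi2 only: this
   is the allowed precomputation. *)
Inductive instr :=
| ZConst (r : nat) (z : int)
| ZAdd (r s t : nat)
| ZSub (r s t : nat)
| ZMul (r s t : nat)
| ZDiv (r s t : nat)
| ZMod (r s t : nat)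
| MSet (m r1 r2 r3 r4 : nat)
| MGet (r m : nat) (i j : 'I_2)
| MMul (m m1 m2 : nat)
| MInv (m m1 : nat)
| VConst (v : nat) (x : algC)
| VAdd (v v1 v2 : nat)
| VMul (v v1 v2 : nat)
| VOpp (v v1 : nat)
| VInv (v v1 : nat)
| VOfInt (v r : nat)
| JLe (r s tgt : nat)
| JEq (r s tgt : nat)
| Jmp (tgt : nat)
| Halt.

Record mstate := MState {
  zreg : nat -> int; mreg : nat -> 'M[int]_2; vreg : nat -> algC; pc : nat }.

Definition upd {T} (f : nat -> T) (r : nat) (x : T) : nat -> T :=
  fun k => if k == r then x else f k.

Definition setZ st r x := MState (upd (zreg st) r x) (mreg st) (vreg st) (pc st).+1.
Definition setM st r x := MState (zreg st) (upd (mreg st) r x) (vreg st) (pc st).+1.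
Definition setV st r x := MState (zreg st) (mreg st) (upd (vreg st) r x) (pc st).+1.
Definition goto st (t : nat) := MState (zreg st) (mreg st) (vreg st) t.
Definition next st := goto st (pc st).+1.

(* One step; None means the machine halts (also when pc leaves the program). *)
Definition step (P : seq instr) (st : mstate) : option mstate :=
  let Z := zreg st in let M := mreg st in let V := vreg st in
  match nth Halt P (pc st) with
  | ZConst r z => Some (setZ st r z)
  | ZAdd r s t => Some (setZ st r (Z s + Z t))
  | ZSub r s t => Some (setZ st r (Z s - Z t))
  | ZMul r s t => Some (setZ st r (Z s * Z t))
  | ZDiv r s t => Some (setZ st r (Z s %/ Z t)%Z)
  | ZMod r s t => Some (setZ st r (Z s %% Z t)%Z)
  | MSet m r1 r2 r3 r4 =>
      Some (setM st m (\matrix_(i < 2, j < 2)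
        if i == i0 then (if j == i0 then Z r1 else Z r2)
                  else (if j == i0 then Z r3 else Z r4)))
  | MGet r m i j => Some (setZ st r (M m i j))
  | MMul m m1 m2 => Some (setM st m (M m1 *m M m2))
  | MInv m m1 => Some (setM st m (\adj (M m1)))
  | VConst v x => Some (setV st v x)
  | VAdd v v1 v2 => Some (setV st v (V v1 + V v2))
  | VMul v v1 v2 => Some (setV st v (V v1 * V v2))
  | VOpp v v1 => Some (setV st v (- V v1))
  | VInv v v1 => Some (setV st v (V v1)^-1)
  | VOfInt v r => Some (setV st v (Z r)%:~R)
  | JLe r s t => Some (if Z r <= Z s then goto st t else next st)
  | JEq r s t => Some (if Z r == Z s then goto st t else next st)
  | Jmp t => Some (goto st t)
  | Halt => None
  end.

(* Run for at most [fuel] steps; Some (value register 0) if the machine has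
   halted within [fuel] steps (the halting step counts as a step). *)
Fixpoint exec (P : seq instr) (fuel : nat) (st : mstate) : option algC :=
  match fuel with
  | 0 => None
  | n.+1 => match step P st with
            | None => Some (vreg st 0)
            | Some st' => exec P n st'
            end
  end.

Definition init_state (g : 'M[int]_2) : mstate :=
  MState (fun k => match k with
                   | 0 => mat_a g | 1 => mat_b g | 2 => mat_c g | 3 => mat_d g
                   | _ => 0 end)%N
         (fun k => if k == 0%N then g else 0)
         (fun _ => 0) 0.

Definition run (P : seq instr) (g : 'M[int]_2) (steps : nat) : option algC :=
  exec P steps (init_state g).

(* Main.v *)
(** For fixed i, the sum over j splits by the residue r of j mod q2 into sums
    over k of a linear function of k times a linear residue (A k + B) mod c.
    The exceptional value of B1 at the integers never matters: since gcd(a, c) = 1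
    and q2 divides c / q1, an integral argument forces q2 | j, so chi2(j) = 0.
    Each of the q1 q2 sums reduces to a sum of
      al + be x + ga y  over  0 <= x < n, 0 <= y < floor((A x + B) / M),
    a family which is stable under reducing A and B mod M (the difference is a
    polynomial in n) and under exchanging A and M.  This is the Euclidean
    algorithm on (M, A), and M (A mod M) at least halves in each round, so
    O(log c) rounds suffice. *)
Require Import Defs.
From mathcomp Require Import all_boot all_order all_algebra all_field.
From mathcomp Require Import zify ring.
Set Implicit Arguments. Unset Strict Implicit. Unset Printing Implicit Defensive.
Import Order.TTheory GRing.Theory Num.Theory.
Local Open Scope ring_scope.

(** * Weighted lattice-point sums under a line and their Euclidean recursion *)

Definition colsum (al be ga x h : int) : int :=
  2 * al * h + 2 * be * x * h + ga * h * (h - 1).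

Definition fsum (n M A B : nat) (al be ga : int) : int :=
  \sum_(x < n) colsum al be ga x%:Z ((A * x + B) %/ M)%N%:Z.

(** Power sums of exponents 0, 1 and 2 with denominators cleared by the factor 6, just as [colsum]
    carries a factor 2; all arithmetic on the machine thus stays integral. *)
Definition quadsum (n c0 c1 c2 : int) : int :=
  6 * n * c0 + 3 * n * (n - 1) * c1 + n * (n - 1) * (2 * n - 1) * c2.

Lemma quadsumE (n : nat) (c0 c1 c2 : int) :
  6 * (\sum_(x < n) (c0 + c1 * x%:Z + c2 * x%:Z ^+ 2)) = quadsum n%:Z c0 c1 c2.
Proof.
elim: n => [|n IH]; first by rewrite big_ord0 /quadsum; ring.
rewrite big_ord_recr /= mulrDr IH /quadsum -[n.+1]addn1 PoszD; ring.
Qed.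

Lemma colsumE (al be ga x : int) (h : nat) :
  colsum al be ga x h%:Z = \sum_(y < h) 2 * (al + be * x + ga * y%:Z).
Proof.
elim: h => [|h IH]; first by rewrite big_ord0 /colsum; ring.
by rewrite big_ord_recr /= -IH /colsum -[h.+1]addn1 PoszD; ring.
Qed.

(** Six times the sum over [x < n] of [colsum al be ga x (s * x + t)], expanded in powers of [x]:
    the contribution of the points below the integral line [s * x + t]. *)
Definition reduce_term (n s t al be ga : int) : int :=
  quadsum n (2 * al * t + ga * t * (t - 1))
    (2 * al * s + 2 * be * t + ga * (2 * s * t - s)) (2 * be * s + ga * s * s).

(** Each column is cut at height [s * x + t]. Shifting [y] by this height in the upper part turns
    [al] into [al + ga * t] and [be] into [be + ga * s]. *)
Lemma fsum_reduce (n M A B : nat) (al be ga : int) : (0 < M)%N ->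
  let s := (A %/ M)%N%:Z in let t := (B %/ M)%N%:Z in
  6 * fsum n M A B al be ga = reduce_term n%:Z s t al be ga
    + 6 * fsum n M (A %% M) (B %% M) (al + ga * t) (be + ga * s) ga.
Proof.
move=> M0 s t; rewrite /reduce_term -quadsumE -mulrDr -big_split /=.
congr (_ * _); apply: eq_bigr => x _.
have -> : ((A * x + B) %/ M = A %/ M * x + B %/ M + (A %% M * x + B %% M) %/ M)%N.
  rewrite {1}(divn_eq A M) {1}(divn_eq B M).
  rewrite (_ : (_ * x + _ = (A %/ M * x + B %/ M) * M + (A %% M * x + B %% M))%N); last by nia.
  by rewrite divnMDl.
rewrite !PoszD PoszM -/s -/t /colsum; ring.
Qed.

(* Rotating the staircase region by a half turn and transposing it exchanges
   the slope [A / M] with [M / A]; the complement of the region is not needed. *)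
Lemma fsum_swap (n M A B : nat) (al be ga : int) : (B < M)%N ->
  let Y := ((A * n + B) %/ M)%N in
  fsum n M A B al be ga =
  fsum Y A M ((A * n + B) %% M) (al + be * (n%:Z - 1) + ga * (Y%:Z - 1)) (- ga) (- be).
Proof.
move=> BM Y; have M0 : (0 < M)%N by lia.
have eY := divn_eq (A * n + B) M; rewrite -/Y in eY.
set B' := ((A * n + B) %% M)%N in eY *.
have lB' : (B' < M)%N by rewrite ltn_mod.
transitivity (\sum_(x < n) \sum_(y < Y | (y.+1 * M <= A * x + B)%N)
    2 * (al + be * x%:Z + ga * y%:Z)).
  apply: eq_bigr => x _; rewrite colsumE.
  rewrite (big_ord_widen Y (fun y : nat => 2 * (al + be * x%:Z + ga * y%:Z))); last first.
    by apply: leq_div2r; have := ltn_ord x; nia.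
  by apply: eq_bigl => y; rewrite leq_divRL.
rewrite (exchange_big_dep predT) //= (reindex_inj rev_ord_inj) /=.
apply: eq_bigr => y _; have yY := ltn_ord y.
(* For [A = 0] the bound [B < M] forces [Y = 0], so there is no row [y]. *)
have A0 : (0 < A)%N.
  rewrite lt0n; apply/eqP => A0.
  have Y0 : Y = 0%N by rewrite /Y A0 mul0n add0n divn_small.
  by move: yY; rewrite [X in (_ < X)%N]Y0.
clearbody Y B'.
(* A row has length at most [n]: for [y < Y], [M * y + B' <= A * n + B - M < A * n]. *)
rewrite colsumE (big_ord_widen n (fun x : nat => 2 * (al + be * (n%:Z - 1) +
  ga * (Y%:Z - 1) + - ga * y%:Z + - be * x%:Z))); last first.
  rewrite -ltnS ltn_divLR //. nia.
rewrite (reindex_inj rev_ord_inj) /=; apply: eq_big => x; have xn := ltn_ord x.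
  rewrite leq_divRL //;
  move: (nat_of_ord x) (nat_of_ord y) xn yY => i j iN jY.
  clear -iN jY eY.
  (* In these coordinates [A * n + B = Y * M + B'] reads [A * k + B + A * (i + 1) = (l + 1) * M + M
     * j + B'], so [(l + 1) * M <= A * k + B] is equivalent to [A * (i + 1) <= M * j + B']. *)
  have [k eN] : exists k, n = (k + i.+1)%N by exists (n - i.+1)%N; rewrite subnK.
  have [l eL] : exists l, Y = (l + j.+1)%N by exists (Y - j.+1)%N; rewrite subnK.
  subst n Y; rewrite !addnK; move: eY.
  rewrite !(mulnDr, mulnDl) !mulSn !mulnS (mulnC M j) (mulnC A i) => eY.
  lia.
move=> _; rewrite -!subzn // !intS; ring.
Qed.

(** With [r = A %% M] and [M = q * r + s], where [q >= 1] and [s < r], one has [M >= r + s > 2 * s];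
    hence [r * s] is less than half of [M * r]. *)
Lemma euclid_potential (M A k : nat) : (0 < M)%N -> (0 < A %% M)%N ->
  (M * (A %% M) < 2 ^ k.+1)%N -> (A %% M * (M %% (A %% M)) < 2 ^ k)%N.
Proof.
move=> M0 r0; rewrite expnS; set r := (A %% M)%N in r0 *.
have rM : (r < M)%N by rewrite ltn_mod.
have := divn_eq M r; have := ltn_pmod M r0.
have : (0 < M %/ r)%N by rewrite divn_gt0 // ltnW.
move: (M %/ r)%N (M %% r)%N => q s q0 sr eM; nia.
Qed.

(** * Step-counted execution and code placement *)

Fixpoint stepn (P : seq instr) (n : nat) (st : mstate) : option mstate :=
  if n is m.+1 then obind (stepn P m) (step P st) else Some st.

(** An upper bound instead of an exact count: budgets add up under composition, and a loop may leave
    early. *)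
Definition reach (P : seq instr) (k : nat) (st st' : mstate) : Prop :=
  exists2 n, (n <= k)%N & stepn P n st = Some st'.

Lemma stepnD P m n st : stepn P (m + n) st = obind (stepn P n) (stepn P m st).
Proof. by elim: m st => //= m IH st; case: (step P st) => //= st'; rewrite IH. Qed.

Lemma stepnS P n st st' : step P st = Some st' -> stepn P n.+1 st = stepn P n st'.
Proof. by move=> /= ->. Qed.

Lemma reach_refl P k st : reach P k st st.
Proof. by exists 0%N. Qed.

Lemma reach_trans P k1 k2 k st1 st2 st3 : reach P k1 st1 st2 -> reach P k2 st2 st3 ->
  (k1 + k2 <= k)%N -> reach P k st1 st3.
Proof.
move=> [n1 l1 e1] [n2 l2 e2] lk; exists (n1 + n2)%N; last by rewrite stepnD e1.
by apply: leq_trans lk; apply: leq_add.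
Qed.

Lemma reach_step P st st' : step P st = Some st' -> reach P 1 st st'.
Proof. by move=> e; exists 1%N; rewrite //= e. Qed.

(** The inequality [k < fuel] is strict because the halting step also consumes fuel. *)
Lemma exec_reach P k fuel st st' : reach P k st st' -> step P st' = None ->
  (k < fuel)%N -> exec P fuel st = Some (vreg st' 0%N).
Proof.
move=> [n nk e] halt kf; have {nk kf} : (n < fuel)%N by apply: leq_ltn_trans kf.
elim: fuel n st e => // fuel IH [|n] st /= e; first by case: e => -> _; rewrite halt.
by case: (step P st) e => //= st1 e /IH; apply.
Qed.

Definition code_at (P : seq instr) (off : nat) (C : seq instr) : Prop :=
  forall i, (i < size C)%N -> nth Halt P (off + i) = nth Halt C i.

Lemma code_at_cat P off C1 C2 : code_at P off (C1 ++ C2) <->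
  code_at P off C1 /\ code_at P (off + size C1) C2.
Proof.
split=> [h|[h1 h2] i].
  split=> i li; first by rewrite h ?nth_cat ?li // size_cat ltn_addr.
  by rewrite -addnA h ?size_cat ?ltn_add2l // nth_cat ltnNge leq_addr addKn.
move=> li; rewrite nth_cat; case: ltnP => [|l2]; first exact: h1.
by rewrite -h2 -?addnA ?subnKC // ltn_subLR // -size_cat.
Qed.

Lemma code_at_cons P off x C : code_at P off (x :: C) <->
  nth Halt P off = x /\ code_at P off.+1 C.
Proof.
rewrite -cat1s code_at_cat addn1; split=> -[h1 h2]; split=> //.
  by have := h1 0%N isT; rewrite addn0.
by case=> //= _; rewrite addn0.
Qed.

(** * Compiling integer expressions and assignments *)

Inductive zexpr :=
| EVar (r : nat)
| ECst (z : int)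
| EAdd (e1 e2 : zexpr)
| ESub (e1 e2 : zexpr)
| EMul (e1 e2 : zexpr)
| EDiv (e1 e2 : zexpr)
| EMod (e1 e2 : zexpr).

Fixpoint eval (Z : nat -> int) (e : zexpr) : int :=
  match e with
  | EVar r => Z r
  | ECst z => z
  | EAdd e1 e2 => eval Z e1 + eval Z e2
  | ESub e1 e2 => eval Z e1 - eval Z e2
  | EMul e1 e2 => eval Z e1 * eval Z e2
  | EDiv e1 e2 => (eval Z e1 %/ eval Z e2)%Z
  | EMod e1 e2 => (eval Z e1 %% eval Z e2)%Z
  end.

Fixpoint below (t : nat) (e : zexpr) : bool :=
  match e with
  | EVar r => (r < t)%N
  | ECst _ => true
  | EAdd e1 e2 | ESub e1 e2 | EMul e1 e2 | EDiv e1 e2 | EMod e1 e2 =>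
      below t e1 && below t e2
  end.

(** The result goes to register [t], and everything from [t] on is scratch space. A variable is
    copied by adding it to zero. *)
Fixpoint compile (t : nat) (e : zexpr) : seq instr :=
  match e with
  | EVar r => [:: ZConst t 0; ZAdd t t r]
  | ECst z => [:: ZConst t z]
  | EAdd e1 e2 => compile t e1 ++ compile t.+1 e2 ++ [:: ZAdd t t t.+1]
  | ESub e1 e2 => compile t e1 ++ compile t.+1 e2 ++ [:: ZSub t t t.+1]
  | EMul e1 e2 => compile t e1 ++ compile t.+1 e2 ++ [:: ZMul t t t.+1]
  | EDiv e1 e2 => compile t e1 ++ compile t.+1 e2 ++ [:: ZDiv t t t.+1]
  | EMod e1 e2 => compile t e1 ++ compile t.+1 e2 ++ [:: ZMod t t t.+1]
  end.

Lemma eval_ext t Z Z' e : below t e -> (forall r, (r < t)%N -> Z' r = Z r) ->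
  eval Z' e = eval Z e.
Proof.
move=> b h; elim: e b => //= e1 IH1 e2 IH2; by case/andP=> /IH1 -> /IH2 ->.
Qed.

Lemma below_leq t t' e : (t <= t')%N -> below t e -> below t' e.
Proof.
move=> l; elim: e => //= [r|e1 IH1 e2 IH2|e1 IH1 e2 IH2|e1 IH1 e2 IH2|e1 IH1 e2 IH2|e1 IH1 e2 IH2];
  first by move=> /leq_trans; apply.
all: by case/andP=> /IH1 -> /IH2 ->.
Qed.

Definition runs_to (P : seq instr) (t : nat) (C : seq instr) (z : (nat -> int) -> int) :=
  forall Z M V p, code_at P p C ->
  exists Z', [/\ reach P (size C) (MState Z M V p) (MState Z' M V (p + size C)),
                 Z' t = z Z & forall r, (r < t)%N -> Z' r = Z r].

(** The second operand starts from registers that the first has altered from [t] on, so its value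
    may depend only on those below [t]; it writes only from [t.+1] on, so the first result
    survives. *)
Lemma runs_to_binop P t C1 C2 z1 z2 x (op : int -> int -> int) :
  (forall st, nth Halt P (pc st) = x ->
     step P st = Some (setZ st t (op (zreg st t) (zreg st t.+1)))) ->
  (forall Z Z', (forall r, (r < t)%N -> Z' r = Z r) -> z2 Z' = z2 Z) ->
  runs_to P t C1 z1 -> runs_to P t.+1 C2 z2 ->
  runs_to P t (C1 ++ C2 ++ [:: x]) (fun Z => op (z1 Z) (z2 Z)).
Proof.
move=> hx ext h1 h2 Z M V p /code_at_cat [c1 /code_at_cat [c2 /code_at_cons [c3 _]]].
have [Z1 [r1 v1 f1]] := h1 Z M V p c1.
have [Z2 [r2 v2 f2]] := h2 Z1 M V _ c2.
exists (upd Z2 t (op (z1 Z) (z2 Z))); split.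
- have /reach_step r3 := hx (MState Z2 M V _) c3.
  rewrite !size_cat /= addn1 !addnS addnA.
  move: r3; rewrite /setZ /= v2 f2 // v1 (ext _ _ f1) => r3.
  by apply: (reach_trans r1 (reach_trans r2 r3 (leqnn _))); rewrite addn1 addnS.
- by rewrite /upd eqxx.
- by move=> r rt; rewrite /upd ltn_eqF // f2 ?f1 // ltnW.
Qed.

Lemma compile_correct P t e : below t e ->
  runs_to P t (compile t e) (fun Z => eval Z e).
Proof.
have ext t' e' : below t' e' -> forall Z Z', (forall r, (r < t')%N -> Z' r = Z r) ->
    eval Z' e' = eval Z e' by move=> ? ? ?; exact: eval_ext.
elim: e t => [r|z|e1 IH1 e2 IH2|e1 IH1 e2 IH2|e1 IH1 e2 IH2|e1 IH1 e2 IH2|e1 IH1 e2 IH2] t /= b.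
- move=> Z M V p /code_at_cons [c1 /code_at_cons [c2 _]].
  exists (upd (upd Z t 0) t (0 + Z r)); split.
  + apply: (@reach_trans _ 1 1 _ _ (MState (upd Z t 0) M V p.+1)) => //.
      by apply: reach_step; rewrite /step /= c1.
    apply: reach_step; rewrite /step /= c2 /setZ /= addn2; congr (Some (MState _ _ _ _)).
    by rewrite /upd eqxx (ltn_eqF b).
  + by rewrite /upd eqxx add0r.
  + by move=> k kt; rewrite /upd ltn_eqF.
- move=> Z M V p /code_at_cons [c1 _]; exists (upd Z t z); split.
  + by apply: reach_step; rewrite /step /= c1 addn1.
  + by rewrite /upd eqxx.
  + by move=> k kt; rewrite /upd ltn_eqF.
all: case/andP: b => b1 b2.
all: have IH := fun op x h =>
  @runs_to_binop P t _ _ _ _ x op h (ext _ _ b2) (IH1 _ b1) (IH2 _ (below_leq (leqnSn t) b2)).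
- by apply: (IH +%R) => st; rewrite /step => ->.
- by apply: (IH (fun x y => x - y)) => st; rewrite /step => ->.
- by apply: (IH *%R) => st; rewrite /step => ->.
- by apply: (IH divz) => st; rewrite /step => ->.
- by apply: (IH modz) => st; rewrite /step => ->.
Qed.

Fixpoint compile_assigns (t : nat) (s : seq (nat * zexpr)) : seq instr :=
  if s is (r, e) :: s' then
    compile t e ++ [:: ZConst t.+1 0; ZAdd r t t.+1] ++ compile_assigns t s'
  else [::].

(** Registers are modelled by a list, so that the effect of a concrete block of assignments is found
    by computation. *)
Fixpoint assigns (l : seq int) (s : seq (nat * zexpr)) : seq int :=
  if s is (r, e) :: s' then assigns (set_nth 0 l r (eval (nth 0 l) e)) s' else l.

Lemma compile_assigns_correct P t s l Z M V p :
  all (fun a => (a.1 < t)%N && below t a.2) s -> code_at P p (compile_assigns t s) ->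
  (forall r, (r < t)%N -> Z r = nth 0 l r) ->
  exists2 Z', reach P (size (compile_assigns t s)) (MState Z M V p)
                (MState Z' M V (p + size (compile_assigns t s)))
            & forall r, (r < t)%N -> Z' r = nth 0 (assigns l s) r.
Proof.
elim: s Z l p => [|[x e] s IH] Z l p /=.
  by exists Z => //; rewrite addn0; exact: reach_refl.
move=> /andP [/andP [xt be] bs] /code_at_cat [c1 /code_at_cons [c2 /code_at_cons [c3 c4]]] hZ.
have [Z1 [r1 v1 f1]] := compile_correct be Z M V c1.
set Z2 := upd (upd Z1 t.+1 0) x (Z1 t).
have hZ2 r : (r < t)%N -> Z2 r = nth 0 (set_nth 0 l x (eval (nth 0 l) e)) r.
  move=> rt; rewrite nth_set_nth /= /Z2 /upd; case: eqP => _.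
    by rewrite v1; exact: eval_ext hZ.
  by rewrite ltn_eqF ?f1 ?hZ // ltnW.
have [Z3 r3 v3] := IH Z2 _ _ bs c4 hZ2; exists Z3 => //.
have r2 : reach P 2 (MState Z1 M V (p + size (compile t e)))
    (MState Z2 M V (p + size (compile t e)).+2).
  apply: (@reach_trans _ 1 1 _ _ (MState (upd Z1 t.+1 0) M V (p + size (compile t e)).+1)) => //.
    by apply: reach_step; rewrite /step /= c2.
  apply: reach_step; rewrite /step /= c3 /setZ /=.
  have -> : upd Z1 t.+1 0 t + upd Z1 t.+1 0 t.+1 = Z1 t; last by [].
  by rewrite /upd eqxx ltn_eqF // addr0.
rewrite size_cat /= addnA !addnS -!addSn.
by apply: (reach_trans r1 (reach_trans r2 r3 (leqnn _))); rewrite !addnS.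
Qed.

(* The Euclidean loop as machine code *)
Declare Scope zexpr_scope.
Delimit Scope zexpr_scope with X.
Bind Scope zexpr_scope with zexpr.
Notation "x + y" := (EAdd x y) : zexpr_scope.
Notation "x - y" := (ESub x y) : zexpr_scope.
Notation "x * y" := (EMul x y) : zexpr_scope.
Notation "x %/ y" := (EDiv x y) : zexpr_scope.
Notation "x %% y" := (EMod x y) : zexpr_scope.

Definition quadsum_expr (n c0 c1 c2 : zexpr) : zexpr :=
  (ECst 6 * n * c0 + ECst 3 * n * (n - ECst 1) * c1
   + n * (n - ECst 1) * (ECst 2 * n - ECst 1) * c2)%X.

(* Registers 0 and 2 hold the entries a and c of the input matrix; 4 to 11 hold
   n, M, A, B, al, be, ga and the accumulator; 12 to 16 are auxiliary, 19 is
   constantly 0, and [compile] uses the registers from 20 on. *)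
Definition loop_body : seq (nat * zexpr) :=
  let n := EVar 4 in let M := EVar 5 in let A := EVar 6 in let B := EVar 7 in
  let al := EVar 8 in let be := EVar 9 in let ga := EVar 10 in let acc := EVar 11 in
  let s := EVar 12 in let t := EVar 13 in let Y := EVar 14 in let B' := EVar 15 in
  let aux := EVar 16 in
  [:: (12, A %/ M); (13, B %/ M); (6, A %% M); (7, B %% M);
      (11, acc + quadsum_expr n (ECst 2 * al * t + ga * t * (t - ECst 1))
             (ECst 2 * al * s + ECst 2 * be * t + ga * (ECst 2 * s * t - s))
             (ECst 2 * be * s + ga * s * s));
      (8, al + ga * t); (9, be + ga * s);
      (14, (A * n + B) %/ M); (15, (A * n + B) %% M);
      (8, al + be * (n - ECst 1) + ga * (Y - ECst 1));
      (16, ECst 0 - ga); (10, ECst 0 - be); (9, aux);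
      (16, M); (5, A); (6, aux); (4, Y); (7, B')]%X%N.

(** Locked to keep the long instruction list from being unfolded by simplification. *)
Definition assembly (s : seq (nat * zexpr)) : seq instr := locked (compile_assigns 20 s).

Lemma assembly_correct P s Z M V p :
  all (fun a => (a.1 < 20)%N && below 20 a.2) s -> code_at P p (assembly s) ->
  exists2 Z', reach P (size (assembly s)) (MState Z M V p) (MState Z' M V (p + size (assembly s)))
            & mkseq Z' 20 = take 20 (assigns (mkseq Z 20) s).
Proof.
rewrite /assembly -lock => ws code.
have [r lr|Z' r hZ'] := compile_assigns_correct (l := mkseq Z 20) (Z := Z) M V ws code.
  by rewrite nth_mkseq.
exists Z' => //; apply: (@eq_from_nth _ 0); last first.
  by move=> i; rewrite size_mkseq => li; rewrite nth_take // nth_mkseq // hZ'.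
have s20 l : (20 <= size l)%N -> (20 <= size (assigns l s))%N.
  elim: (s) l => //= -[x e] s' IH l l20; apply: IH.
  by rewrite size_set_nth leq_max l20 orbT.
by rewrite size_mkseq size_takel // s20 // size_mkseq.
Qed.

(** Jump targets are absolute, hence the parameter [off]. The loop ends when [M = 0], and the exit
    target is the first address behind it. *)
Definition loop_code (off : nat) : seq instr :=
  JEq 5 19 (off + (size (assembly loop_body)).+2)
  :: assembly loop_body ++ [:: Jmp off].

Lemma size_loop_code off :
  size (loop_code off) = (size (assembly loop_body)).+2.
Proof. by rewrite /= size_cat addn1. Qed.

Definition loop_state (Z : nat -> int) (n M A B : nat) (al be ga acc : int) : Prop :=
  Z 19%N = 0 /\
  [seq Z r | r <- iota 4 8] = [:: n%:Z; M%:Z; A%:Z; B%:Z; al; be; ga; acc].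

Lemma loop_exit P off Z Mr V n A B al be ga acc : code_at P off (loop_code off) ->
  loop_state Z n 0 A B al be ga acc ->
  reach P 1 (MState Z Mr V off) (MState Z Mr V (off + size (loop_code off))).
Proof.
move=> /code_at_cons [c1 _] [z0 [_ zM _ _ _ _ _ _]].
by apply: reach_step; rewrite /step /= c1 zM z0 eqxx size_cat addn1.
Qed.

(** One round is [fsum_reduce] followed by [fsum_swap]; the invariant is the accumulator plus six
    times the remaining [fsum]. *)
Lemma loop_iter P off Z Mr V n M A B al be ga acc : code_at P off (loop_code off) ->
  (0 < M)%N -> loop_state Z n M A B al be ga acc ->
  exists Z' n' B' al' be' ga' acc',
   [/\ reach P (size (loop_code off)) (MState Z Mr V off) (MState Z' Mr V off),
       loop_state Z' n' (A %% M) M B' al' be' ga' acc',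
       acc + 6 * fsum n M A B al be ga = acc' + 6 * fsum n' (A %% M) M B' al' be' ga'
     & forall r, (r < 4)%N -> Z' r = Z r].
Proof.
move=> /code_at_cons [c1 /code_at_cat [c2 /code_at_cons [c3 _]]] M0.
move=> [z0 [zn zM zA zB zal zbe zga zacc]].
have [Z' r2 hZ'] := @assembly_correct P loop_body Z Mr V off.+1 isT c2.
(* [lazy] shares subterms; [simpl] is exponential in the number of assignments. *)
move: hZ'; lazy [mkseq iota map loop_body quadsum_expr assigns set_nth eval nth take].
rewrite z0 zn zM zA zB zal zbe zga zacc.
rewrite !sub0r !divz_nat !modz_nat -!PoszM -!PoszD !divz_nat ?modz_nat.
set s := (A %/ M)%N; set t := (B %/ M)%N; set A' := (A %% M)%N; set B' := (B %% M)%N.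
have eY := fsum_swap n A' (al + ga * t%:Z) (be + ga * s%:Z) ga (ltn_pmod B M0).
rewrite -/B' in eY.
move=> [e0 e1 e2 e3 e4 e5 e6 e7 e8 e9 e10 e11 _ _ _ _ _ _ _ e19].
exists Z', ((A' * n + B') %/ M)%N, ((A' * n + B') %% M)%N.
set Y := ((A' * n + B') %/ M)%N in eY *.
exists ((al + ga * t%:Z) + (be + ga * s%:Z) * (n%:Z - 1) + ga * (Y%:Z - 1)).
exists (- ga), (- (be + ga * s%:Z)), (acc + reduce_term n%:Z s%:Z t%:Z al be ga); split.
- apply: (@reach_trans _ 1 _ _ _ (MState Z Mr V off.+1)).
  + apply: reach_step; rewrite /step /= c1 zM z0.
    by have /negbTE -> : M%:Z != 0 by lia.
  + apply: (reach_trans r2); last exact: leqnn.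
    by apply: reach_step; rewrite /step /= c3.
  + by rewrite /= size_cat addn1.
- by split; rewrite //= e4 e5 e6 e7 e8 e9 e10 e11.
- by rewrite (fsum_reduce _ _ _ _ _ _ M0) eY addrA.
- by do 4 case=> //.
Qed.

Definition loop_result P off Mr V k Z n M A B al be ga acc : Prop :=
  exists Z', [/\ reach P (k * size (loop_code off)) (MState Z Mr V off)
                   (MState Z' Mr V (off + size (loop_code off))),
    Z' 11%N = acc + 6 * fsum n M A B al be ga
  & forall r, (r < 4)%N -> Z' r = Z r].

(** By [euclid_potential] the exponent [k] drops in each round while [A %% M] is positive. The two
    extra rounds are the one with [A %% M = 0] and the exit test. *)
Lemma loop_correct P off Mr V k Z n M A B al be ga acc :
  code_at P off (loop_code off) -> (M * (A %% M) < 2 ^ k)%N ->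
  loop_state Z n M A B al be ga acc ->
  loop_result P off Mr V k.+2 Z n M A B al be ga acc.
Proof.
move=> code; have s1 : (1 <= size (loop_code off))%N by rewrite size_loop_code.
have exit k' Z1 n1 A1 B1 al1 be1 ga1 acc1 : loop_state Z1 n1 0 A1 B1 al1 be1 ga1 acc1 ->
    loop_result P off Mr V k'.+1 Z1 n1 0 A1 B1 al1 be1 ga1 acc1.
  move=> h; exists Z1; split=> //.
    apply: (reach_trans (loop_exit Mr V code h) (reach_refl P 0 _)).
    by rewrite addn0 (leq_trans s1) // leq_pmull.
  (* Since [m %/ 0 = 0], all columns are empty at [M = 0] and the remaining [fsum] vanishes. *)
  case: h => _ [_ _ _ _ _ _ _ ->]; rewrite /fsum big1 ?mulr0 ?addr0 // => x _.
  by rewrite divn0 /colsum; ring.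
have iter k' Z1 n1 M1 A1 B1 al1 be1 ga1 acc1 : (0 < M1)%N ->
    loop_state Z1 n1 M1 A1 B1 al1 be1 ga1 acc1 ->
    (forall Z2 n2 B2 al2 be2 ga2 acc2, loop_state Z2 n2 (A1 %% M1) M1 B2 al2 be2 ga2 acc2 ->
       loop_result P off Mr V k' Z2 n2 (A1 %% M1) M1 B2 al2 be2 ga2 acc2) ->
    loop_result P off Mr V k'.+1 Z1 n1 M1 A1 B1 al1 be1 ga1 acc1.
  move=> M0 h IH.
  have [Z2 [n2 [B2 [al2 [be2 [ga2 [acc2 [r2 h2 e2 f2]]]]]]]] := loop_iter Mr V code M0 h.
  have [Z3 [r3 e3 f3]] := IH _ _ _ _ _ _ _ h2; exists Z3; split.
  - by apply: (reach_trans r2 r3); rewrite mulSn.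
  - by rewrite e3 e2.
  - by move=> r lr; rewrite f3 ?f2.
elim: k Z n M A B al be ga acc => [|k IH] Z n [|M] A B al be ga acc lk h; try exact: exit h.
  apply: iter (h) _ => // Z2 n2 B2 al2 be2 ga2 acc2.
  by move: lk; rewrite expn0 ltnS leqn0 muln_eq0 => /eqP -> /exit; apply.
apply: iter (h) _ => // Z2 n2 B2 al2 be2 ga2 acc2.
have [-> /exit h2|r0] := posnP (A %% M.+1); first exact: h2.
by apply: IH; exact: euclid_potential r0 lk.
Qed.

(** * The sum over one residue class modulo [q2] *)

(** With [j = r + q2 * k], the factors are [2 * c] times the two sawtooth values at [j / c] and
    [i / q1 + a * j / c], ignoring the exceptional value at integers. *)
Definition sawtooth_sum (a c : int) (q1 q2 i r : nat) : int :=
  \sum_(k < absz (c %/ q2%:Z)%Z) (2 * r%:Z - c + 2 * q2%:Z * k%:Z) *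
    (2 * ((a * (r%:Z + q2%:Z * k%:Z) + i%:Z * (c %/ q1%:Z)%Z) %% c)%Z - c).

(** Substituting [A * k + B - M * h] for the residue, with [h] the quotient, leaves a quadratic
    polynomial in [k] minus [2 * M * (u + v * k) * h]; the latter is an [fsum] with [ga = 0]. *)
Lemma linear_mod_sum (n M A B : nat) (u v : int) :
  2 * quadsum n%:Z (u * (2 * B%:Z - M%:Z))
     (v * (2 * B%:Z - M%:Z) + 2 * A%:Z * u) (2 * v * A%:Z)
   + 6 * fsum n M A B (- (2 * M%:Z * u)) (- (2 * M%:Z * v)) 0 =
  12 * \sum_(k < n) (u + v * k%:Z) * (2 * ((A * k + B) %% M)%N%:Z - M%:Z).
Proof.
rewrite -quadsumE /fsum !mulr_sumr -big_split; apply: eq_bigr => x _ /=.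
have := divn_eq (A * x + B) M; set h := ((_ + _) %/ _)%N; set m := ((_ + _) %% _)%N.
move=> /(congr1 Posz); rewrite !PoszD !PoszM => e.
have -> : B%:Z = h%:Z * M%:Z + m%:Z - A%:Z * x%:Z by rewrite -e; ring.
rewrite /colsum; ring.
Qed.

(** Sets up [linear_mod_sum] with [u = 2 * r - c] and [v = 2 * q2]. The coefficients [A] and [B] are
    reduced modulo [c] first, which makes them natural numbers even for negative [a]. *)
Definition block_init (q1 q2 i r : nat) : seq (nat * zexpr) :=
  let a := EVar 0 in let c := EVar 2 in
  let n := EVar 4 in let M := EVar 5 in let A := EVar 6 in let B := EVar 7 in
  let u := EVar 12 in let e := EVar 13 in let v := ECst (2 * q2%:Z) in
  [:: (19, ECst 0); (4, c %/ ECst q2%:Z); (5, c + ECst 0); (6, (a * ECst q2%:Z) %% c);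
      (7, (a * ECst r%:Z + ECst i%:Z * (c %/ ECst q1%:Z)) %% c);
      (12, ECst (2 * r%:Z) - c); (13, ECst 2 * B - M);
      (8, ECst 0 - ECst 2 * M * u); (9, ECst 0 - ECst 2 * M * v); (10, ECst 0);
      (11, ECst 2 * quadsum_expr n (u * e) (v * e + ECst 2 * A * u) (ECst 2 * v * A))]%X%N.

Definition block_code (q1 q2 off : nat) (task : nat * nat * algC) : seq instr :=
  let init := assembly (block_init q1 q2 task.1.1 task.1.2) in
  init ++ loop_code (off + size init)
       ++ [:: VOfInt 1 11; VConst 2 task.2; VMul 1 1 2; VAdd 0 0 1].

Lemma block_correct P off q1 q2 i r w Z Mr V (a : int) (c : nat) :
  code_at P off (block_code q1 q2 off (i, r, w)) -> (0 < c)%N ->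
  Z 0%N = a -> Z 2%N = c%:Z ->
  exists Z' V', [/\ reach P ((trunc_log 2 c).+1 * (4 * size (block_code q1 q2 off (i, r, w))))
          (MState Z Mr V off)
          (MState Z' Mr V' (off + size (block_code q1 q2 off (i, r, w)))),
    V' 0%N = V 0%N + (12 * sawtooth_sum a c%:Z q1 q2 i r)%:~R * w, Z' 0%N = a
  & Z' 2%N = c%:Z].
Proof.
set S := size _; set lp := loop_code (off + size (assembly (block_init q1 q2 i r))).
have eS : S = (size (assembly (block_init q1 q2 i r)) + (size lp + 4))%N.
  by rewrite /S /block_code !size_cat.
move: S eS => S eS code c0 za zc.
have /code_at_cat [c1 /code_at_cat [c2 c3]] : code_at P off (assembly (block_init q1 q2 i r) ++
  lp ++ [:: VOfInt 1 11; VConst 2 w; VMul 1 1 2; VAdd 0 0 1]) := code.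
have c0' : c%:Z != 0 by lia.
have [Z1 r1] := @assembly_correct P (block_init q1 q2 i r) Z Mr V off isT c1.
lazy [mkseq iota map block_init quadsum_expr assigns set_nth eval nth take]; rewrite za zc.
rewrite -(gez0_abs (modz_ge0 (a * q2%:Z) c0')).
rewrite -(gez0_abs (modz_ge0 (a * r%:Z + i%:Z * (c%:Z %/ q1%:Z)%Z) c0')).
set A := absz _; set B := absz _; rewrite !sub0r addr0 divz_nat.
move=> [e0 e1 e2 e3 e4 e5 e6 e7 e8 e9 e10 e11 _ _ _ _ _ _ _ e19].
(* Both factors are below [2 ^ (l + 1)] for [l = trunc_log 2 c], so [2 * (l + 1) + 2] rounds
   suffice, at most [4 * (l + 1)]. *)
have lk : (c * (A %% c) < 2 ^ (2 * (trunc_log 2 c).+1))%N.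
  rewrite mul2n -addnn expnD.
  have lc := trunc_log_ltn c (isT : (1 < 2)%N).
  by apply: ltn_mul => //; apply: ltn_trans (ltn_pmod A c0) lc.
have h1 : loop_state Z1 (c %/ q2) c A B (Z1 8%N) (Z1 9%N) 0 (Z1 11%N).
  by split; rewrite //= e4 e5 e6 e7 e10.
have [Z2 [r2 f2 g2]] := loop_correct Mr V c2 lk h1.
move: c3 => /code_at_cons [c31 /code_at_cons [c32 /code_at_cons [c33 /code_at_cons [c34 _]]]].
pose V1 := upd V 1 (Z2 11%N)%:~R; pose V2 := upd V1 2 w.
pose V3 := upd V2 1 (V2 1%N * V2 2%N); pose V4 := upd V3 0 (V3 0%N + V3 1%N).
exists Z2, V4; split.
- have r3 : reach P 4 (MState Z2 Mr V (off + size (assembly (block_init q1 q2 i r)) + size lp))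
                      (MState Z2 Mr V4 (off + S)).
    rewrite eS !addnA addn4; move: (_ + size lp)%N c31 c32 c33 c34 => p c31 c32 c33 c34.
    exists 4%N => //.
    rewrite (@stepnS _ _ _ (MState Z2 Mr V1 p.+1)); last by rewrite /step /= c31.
    rewrite (@stepnS _ _ _ (MState Z2 Mr V2 p.+2)); last by rewrite /step /= c32.
    rewrite (@stepnS _ _ _ (MState Z2 Mr V3 p.+3)); last by rewrite /step /= c33.
    by rewrite /= /step /= c34.
  apply: (reach_trans r1 (reach_trans r2 r3 (leqnn _))).
  rewrite eS; move: (size _) (size lp) (trunc_log _ _) => x y l; clear; nia.
- have eW : Z2 11%N = 12 * sawtooth_sum a c%:Z q1 q2 i r.
    have {}e11 : Z1 11%N = 2 * quadsum (c %/ q2)%N%:Z ((2 * r%:Z - c%:Z) * (2 * B%:Z - c%:Z))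
     (2 * q2%:Z * (2 * B%:Z - c%:Z) + 2 * A%:Z * (2 * r%:Z - c%:Z)) (2 * (2 * q2%:Z) * A%:Z) := e11.
    rewrite f2 e11 e8 e9 linear_mod_sum.
    rewrite /sawtooth_sum divz_nat absz_nat; congr (_ * _).
  apply: eq_bigr => k _; congr (_ * (2 * _ - _)).
  rewrite -modz_nat PoszD PoszM /A /B !gez0_abs ?modz_ge0 //.
  rewrite modzDmr -modzDml modzMml modzDml; congr (_ %% _)%Z; rewrite divz_nat; ring.
  by rewrite /V4 /V3 /V2 /V1 /upd /= eW.
- by rewrite g2.
- by rewrite g2.
Qed.

(** * The complete program and its running time *)

Fixpoint blocks (q1 q2 off : nat) (ts : seq (nat * nat * algC)) : seq instr :=
  if ts is t :: ts' then
    block_code q1 q2 off t ++ blocks q1 q2 (off + size (block_code q1 q2 off t)) ts'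
  else [::].

Definition weighted_sum (a c : int) (q1 q2 : nat) (ts : seq (nat * nat * algC)) : algC :=
  \sum_(t <- ts) (12 * sawtooth_sum a c q1 q2 t.1.1 t.1.2)%:~R * t.2.

Lemma blocks_correct P off q1 q2 ts Z Mr V (a : int) (c : nat) :
  code_at P off (blocks q1 q2 off ts) -> (0 < c)%N -> Z 0%N = a -> Z 2%N = c%:Z ->
  exists Z' V', [/\ reach P ((trunc_log 2 c).+1 * (4 * size (blocks q1 q2 off ts)))
          (MState Z Mr V off) (MState Z' Mr V' (off + size (blocks q1 q2 off ts))),
    V' 0%N = V 0%N + weighted_sum a c%:Z q1 q2 ts & Z' 2%N = c%:Z].
Proof.
move=> + c0; elim: ts off Z V => [|[[i r] w] ts IH] off Z V.
  move=> _ _ zc; exists Z, V; rewrite /weighted_sum big_nil addr0 addn0; split=> //.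
  exact: reach_refl.
move=> /code_at_cat [h1 h2] za zc.
have [Z1 [V1 [r1 v1 za1 zc1]]] := block_correct Mr V h1 c0 za zc.
have [Z2 [V2 [r2 v2 zc2]]] := IH _ _ V1 h2 za1 zc1.
exists Z2, V2; split=> //; last by rewrite v2 v1 /weighted_sum big_cons addrA.
rewrite -[blocks _ _ _ _]/(_ ++ _) size_cat addnA.
by apply: (reach_trans r1 r2); rewrite -mulnDr leq_mul2l -mulnDr leqnn orbT.
Qed.

(** The divisor [48 * c * c] combines the factor 12 of [linear_mod_sum] with the two denominators
    [2 * c] of the sawtooth values. *)
Definition program (q1 q2 : nat) (ts : seq (nat * nat * algC)) : seq instr :=
  blocks q1 q2 0 ts ++
  [:: VOfInt 1 2; VConst 2 48; VMul 2 2 1; VMul 2 2 1; VInv 2 2; VMul 0 0 2].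

Lemma program_correct q1 q2 ts (g : 'M[int]_2) : 0 < mat_c g ->
  run (program q1 q2 ts) g
    ((4 * size (program q1 q2 ts)) * (trunc_log 2 (absz (mat_c g))).+1) =
  Some (weighted_sum (mat_a g) (mat_c g) q1 q2 ts / (48 * (mat_c g)%:~R * (mat_c g)%:~R)).
Proof.
move=> c0; set P := program _ _ _; set l := trunc_log _ _.
have ec : (absz (mat_c g))%:Z = mat_c g by rewrite gez0_abs // ltW.
have c0' : (0 < absz (mat_c g))%N by lia.
have /code_at_cat [h1] : code_at P 0 P by [].
rewrite add0n => /code_at_cons [i1 /code_at_cons [i2 /code_at_cons [i3 /code_at_cons
  [i4 /code_at_cons [i5 /code_at_cons [i6 _]]]]]].
have [Z [V [r1 v1 zc]]] := blocks_correct (Z := zreg (init_state g)) (mreg (init_state g))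
  (vreg (init_state g)) h1 c0' (erefl _) (esym ec).
rewrite ec add0r in v1 zc; rewrite add0n -/l in r1.
set p := size (blocks q1 q2 0 ts) in r1 i1 i2 i3 i4 i5 i6.
have eP : size P = (p + 6)%N by rewrite /P /program size_cat.
pose V1 := upd V 1 (mat_c g)%:~R; pose V2 := upd V1 2 48.
pose V3 := upd V2 2 (V2 2%N * V2 1%N); pose V4 := upd V3 2 (V3 2%N * V3 1%N).
pose V5 := upd V4 2 (V4 2%N)^-1; pose V6 := upd V5 0 (V5 0%N * V5 2%N).
have r2 : reach P 6 (MState Z (mreg (init_state g)) V p)
                    (MState Z (mreg (init_state g)) V6 (p + 6)).
  exists 6%N; rewrite // addnC.
  rewrite (@stepnS _ _ _ (MState Z (mreg (init_state g)) V1 p.+1)); last first.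
    by rewrite /step i1 /setV /= zc.
  rewrite (@stepnS _ _ _ (MState Z (mreg (init_state g)) V2 p.+2)); last by rewrite /step i2.
  rewrite (@stepnS _ _ _ (MState Z (mreg (init_state g)) V3 p.+3)); last by rewrite /step i3.
  rewrite (@stepnS _ _ _ (MState Z (mreg (init_state g)) V4 p.+4)); last by rewrite /step i4.
  rewrite (@stepnS _ _ _ (MState Z (mreg (init_state g)) V5 p.+4.+1)); last by rewrite /step i5.
  by rewrite (@stepnS _ _ _ (MState Z (mreg (init_state g)) V6 p.+4.+2)) // /step i6.
(* The counter has left the program, where [nth] returns its default [Halt]. *)
have halt : step P (MState Z (mreg (init_state g)) V6 (p + 6)) = None.
  by rewrite /step /= nth_default // eP.
(* The last six instructions enter the bound as [24 * (l + 1)], which covers their six steps and the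
   halting step. *)
rewrite /run (exec_reach (reach_trans r1 r2 (leqnn _)) halt); last first.
  by rewrite eP; move: (p) (l) => x y; clear; nia.
by congr Some; rewrite /V6 /V5 /V4 /V3 /V2 /V1 /upd /= v1.
Qed.

(** * From the Dedekind sum to the weighted sum of the program *)

Lemma B1_frac (n c : int) : 0 < c -> ~~ (c %| n)%Z ->
  B1 (n%:~R / c%:~R) = (2 * (n %% c)%Z - c)%:~R / (2 * c%:~R).
Proof.
move=> c0 cn; have cR : (0 : rat) < c%:~R by rewrite ltr0z.
have cN : (c%:~R : rat) != 0 by rewrite gt_eqF.
have cZ : c != 0 by rewrite gt_eqF.
have m0 : 0 < (n %% c)%Z.
  by rewrite lt0r modz_ge0 // andbT; apply: contra cn => /eqP /dvdz_mod0P.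
have en : (n%:~R : rat) = (n %/ c)%Z%:~R * c%:~R + (n %% c)%Z%:~R.
  by rewrite {1}(divz_eq n c) rmorphD rmorphM.
have fl : Num.floor (n%:~R / c%:~R : rat) = (n %/ c)%Z.
  apply: floor_def; rewrite ler_pdivlMr // ltr_pdivrMr // en intrD mulrDl mul1r.
  by rewrite lerDl ltrD2l ler0z ltr_int ltz_pmod // ltW.
rewrite /B1 intrEfloor fl; case: eqP => [e|_].
  move/(congr1 (fun x => x * c%:~R)): e; rewrite divfK // en => /eqP.
  by rewrite -subr_eq0 opprD addrA subrr sub0r oppr_eq0 intr_eq0 gt_eqF.
rewrite {}en; move: (n %% c)%Z (n %/ c)%Z => r s; rewrite intrB intrM; field; exact: cN.
Qed.

(** The equation [a * d - b * c = 1] is a Bezout relation. *)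
Lemma coprimez_column (g : 'M[int]_2) : \det g = 1 -> coprimez (mat_a g) (mat_c g).
Proof.
rewrite (expand_det_row _ i0) !big_ord_recl big_ord0 /cofactor !det_mx11 !mxE /= => e.
apply/coprimezP; exists (mat_d g, - mat_b g) => /=; rewrite -e /mat_a /mat_b /mat_c /mat_d.
have eo (x y : 'I_2) : val x = val y -> x = y by exact: val_inj.
have -> : lift (lift ord0 ord0) 0 = i0 :> 'I_2 by exact: eo.
have -> : lift ord0 0 = i1 :> 'I_2 by exact: eo.
have -> : lift i0 0 = i1 :> 'I_2 by exact: eo.
have -> : ord0 = i0 :> 'I_2 by exact: eo.
rewrite addr0 expr0 expr1; ring.
Qed.

Lemma dirichlet_char_multiple (q : nat) (chi : int -> algC) (n : int) : 
  (1 < q)%N -> dirichlet_char q chi -> (q%:Z %| n)%Z -> chi n = 0.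
Proof.
move=> q1 [_ _ _ h] qn; apply/eqP; apply/negPn; rewrite h; apply/negP => co.
have : coprimez q%:Z q%:Z by apply: coprimez_dvdl qn co.
by rewrite coprimezE /coprime gcdnn; apply/negP; rewrite absz_nat; case: (q) q1 => [|[]].
Qed.

Lemma dirichlet_char_period (q : nat) (chi : int -> algC) (n : int) (k : nat) :
  dirichlet_char q chi -> chi (n + q%:Z * k%:Z) = chi n.
Proof.
case=> _ _ h _; elim: k => [|k IH]; first by rewrite mulr0 addr0.
by rewrite -addn1 PoszD mulrDr mulr1 addrA h.
Qed.

Lemma dedekind_term (a c : int) (q1 q2 : nat) (chi1 chi2 : int -> algC) (i j : nat) :
  (1 < q2)%N -> dirichlet_char q2 chi2 -> 0 < c -> ((q1 * q2)%N%:Z %| c)%Z ->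
  coprimez a c -> (j < absz c)%N ->
  (chi2 j%:Z * chi1 i%:Z)^* * ratr (B1 (j%:Q / c%:~R)) *
     ratr (B1 (i%:Q / q1%:Q + a%:~R * j%:Q / c%:~R)) =
  (chi2 j%:Z * chi1 i%:Z)^* *
  ((2 * j%:Z - c) * (2 * ((a * j%:Z + i%:Z * (c %/ q1%:Z)%Z) %% c)%Z - c))%:~R / (4 * c%:~R * c%:~R).
Proof.
move=> q21 chi2c c0 Nc co jc.
have jmod : (j%:Z %% c)%Z = j%:Z by rewrite modz_small //; lia.
have [q1c q2c] : (q1%:Z %| c)%Z /\ (q2%:Z %| (c %/ q1%:Z)%Z)%Z.
  case/dvdzP: Nc => k ek; have q10 : q1%:Z != 0.
    by apply: contraTneq c0 => q10; rewrite ek PoszM q10 mul0r mulr0 ltxx.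
  rewrite ek PoszM mulrCA dvdz_mulr ?dvdzz // mulKz //; split=> //.
  by rewrite dvdz_mull.
have [->|chij] := eqVneq (chi2 j%:Z) 0; first by rewrite mul0r rmorph0 !mul0r.
have q2j : ~~ (q2%:Z %| j%:Z)%Z.
  by apply: contra chij => /(dirichlet_char_multiple q21 chi2c) ->.
set c' := (c %/ q1%:Z)%Z in q2c *.
have ec : c = c' * q1%:Z by rewrite divzK.
have cj : ~~ (c %| j%:Z)%Z.
  apply: contra q2j; apply: dvdz_trans; apply: (dvdz_trans q2c).
  by rewrite ec dvdz_mulr.
(* Here [c' = c / q1] is a multiple of [q2]. If [c] divided the sum, then [c'] would divide [a * j],
   hence [j] by coprimality with [a], and so [q2] would divide [j]. *)
have cn : ~~ (c %| a * j%:Z + i%:Z * c')%Z.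
  apply: contra q2j => h; apply: (dvdz_trans q2c).
  have : (c' %| a * j%:Z + i%:Z * c')%Z by apply: dvdz_trans h; rewrite ec dvdz_mulr.
  move=> h'; suff: (c' %| a * j%:Z)%Z.
    rewrite Gauss_dvdzr //.
    by rewrite coprimez_sym; apply: coprimez_dvdr co; rewrite -dvdzE ec dvdz_mulr.
  by rewrite -[a * _](addrK (i%:Z * c')) rpredB // dvdz_mull.
have cN : (c%:~R : rat) != 0 by rewrite intr_eq0 gt_eqF.
have q1N : (q1%:Q : rat) != 0.
  by apply: contraNneq cN => q10; rewrite ec rmorphM /= q10 mulr0.
have -> : i%:Q / q1%:Q + a%:~R * j%:Q / c%:~R = (a * j%:Z + i%:Z * c')%:~R / c%:~R.
  have ecR : (c%:~R : rat) = c'%:~R * q1%:Q by rewrite {1}ec rmorphM.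
  rewrite rmorphD !rmorphM /= ecR; field.
  by rewrite q1N /=; apply: contraNneq cN => h; rewrite ecR h mul0r.
rewrite (B1_frac c0 cj) (B1_frac c0 cn) jmod.
rewrite !(rmorphM, fmorphV) /= !ratr_int !rmorph_nat -!mulrA; congr (_ * _).
have cC : (c%:~R : algC) != 0 by rewrite intr_eq0 gt_eqF.
by field; rewrite cC.
Qed.

Definition char_tasks (q1 q2 : nat) (chi1 chi2 : int -> algC) : seq (nat * nat * algC) :=
  [seq ((i, r), (chi2 r%:Z * chi1 i%:Z)^*) | i <- index_iota 1 q1.+1, r <- index_iota 0 q2].

Lemma dedekindS_weighted_sum (q1 q2 : nat) (chi1 chi2 : int -> algC) (g : 'M[int]_2) :
  (1 < q2)%N -> dirichlet_char q2 chi2 -> Gamma0 (q1 * q2) g -> 0 < mat_c g ->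
  dedekindS q1 chi1 chi2 g =
  weighted_sum (mat_a g) (mat_c g) q1 q2 (char_tasks q1 q2 chi1 chi2)
    / (48 * (mat_c g)%:~R * (mat_c g)%:~R).
Proof.
move=> q21 chi2c [dg Nc] c0; have co := coprimez_column dg.
rewrite /dedekindS; move: (mat_a g) (mat_c g) co Nc c0 => a c co Nc c0.
have term := dedekind_term chi1 _ q21 chi2c c0 Nc co.
have q2c : (q2%:Z %| c)%Z by apply: dvdz_trans Nc; rewrite PoszM dvdz_mull.
have [C ec] : exists C, c = Posz C by exists (absz c); rewrite gez0_abs // ltW.
have C0 : (0 < C)%N by lia.
rewrite [absz c](_ : _ = C); last by rewrite ec.
(* The range [1..c] is traded for [0..c-1]: the terms at [j = c] and [j = 0] both vanish, as [q2]
   divides [c] and [0]. *)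
rewrite big_nat_recr //= [X in _ + X]big1 ?addr0; last first.
  move=> i _; rewrite (dirichlet_char_multiple q21 chi2c); first by rewrite mul0r rmorph0 !mul0r.
  by rewrite -ec.
pose T (i j : nat) : algC := (chi2 j%:Z * chi1 i%:Z)^* *
  ((2 * j%:Z - c) * (2 * ((a * j%:Z + i%:Z * (c %/ q1%:Z)%Z) %% c)%Z - c))%:~R / (4 * c%:~R * c%:~R).
transitivity (\sum_(0 <= j < C) \sum_(1 <= i < q1.+1) T i j).
  rewrite [RHS]big_ltn // [X in X + _]big1 ?add0r; last first.
    move=> i _; rewrite /T (dirichlet_char_multiple q21 chi2c) ?dvdz0 //.
    by rewrite mul0r rmorph0 !mul0r.
  apply: eq_big_nat => j /andP [_ jC]; apply: eq_bigr => i _.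
  by apply: term; rewrite ec.
set m := absz (c %/ q2%:Z)%Z.
have eC : C = (m * q2)%N.
  rewrite /m ec divz_nat absz_nat divnK //; move: q2c; by rewrite ec.
rewrite exchange_big eC /weighted_sum /char_tasks big_allpairs_dep mulr_suml; apply: eq_bigr => i _ /=.
rewrite big_nat_mul mulr_suml.
(* Division of [j] by [q2]: since [q2] divides [c], the residue classes all have [m] elements, and
   [chi2 j] depends on [r] alone. *)
transitivity (\sum_(0 <= k < m) \sum_(0 <= r < q2) T i (r + k * q2)%N).
  apply: eq_bigr => k _; rewrite -{1}[(k * q2)%N]add0n big_addn mulSn addnK //.
rewrite exchange_big; apply: eq_bigr => r _.
have cC : (c%:~R : algC) != 0 by rewrite intr_eq0 gt_eqF.
rewrite /sawtooth_sum -/m intrM rmorph_sum /= mulr_sumr !mulr_suml big_mkord.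
apply: eq_bigr => k _; rewrite /T.
have ej : (r + k * q2)%N%:Z = r%:Z + q2%:Z * k%:Z by rewrite PoszD PoszM (mulrC k%:Z).
rewrite ej (dirichlet_char_period _ _ chi2c).
rewrite (_ : 2 * (r%:Z + q2%:Z * k%:Z) - c = 2 * r%:Z - c + 2 * q2%:Z * k%:Z); last by ring.
move: (_ * _ : int) (_^* : algC) => x w; field; exact: cC.
Qed.

Theorem theorem1p4 (q1 q2 : nat) (chi1 chi2 : int -> algC) :
  (1 < q1)%N -> (1 < q2)%N ->
  primitive_char q1 chi1 -> primitive_char q2 chi2 ->
  chi1 (-1) * chi2 (-1) = 1 ->
  exists (P : seq instr) (K : nat),
    forall g : 'M[int]_2, Gamma0 (q1 * q2) g -> 0 < mat_c g ->
      run P g (K * (trunc_log 2 (absz (mat_c g))).+1) = Some (dedekindS q1 chi1 chi2 g).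
Proof.
move=> _ q21 _ [chi2c _] _.
(* The character values are constants of the program, with one block per pair [(i, r)]; its length,
   and hence the constant [K], is independent of [g]. *)
exists (program q1 q2 (char_tasks q1 q2 chi1 chi2)).
exists (4 * size (program q1 q2 (char_tasks q1 q2 chi1 chi2)))%N => g Gg c0.
by rewrite program_correct // -dedekindS_weighted_sum.
Qed.
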